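(* Let $\mathbb{G}=(\mathcal{V},\mathcal{E})$ be a connected simple undirected graph with $n>1$ vertices, and let $W$ satisfy Assumption A. Then for any initial value $\mathbf{x}(0)\in\mathbb{R}^n$ of the quantized system, there is a finite time $k_0$ such that at least one of the following holds: (1) the values of the nodes are cycling in a small neighborhood around the average, i.e. there is an integer $P\ge1$ with $\mathbf{x}(k+P)=\mathbf{x}(k)$ for all $k\ge k_0$, and for all $k\ge k_0$ $$|x_i(k)-x_j(k)|\le\alpha_i+\alpha_j\ \text{ for all } i,j\in\mathcal{V},\qquad |x_i(k)-x_{ave}|\le2\alpha\ \text{ for all } i\in\mathcal{V};$$ (2) the quantized values have reached consensus, i.e. for all $k\ge k_0$ $$\lfloor x_i(k)\rfloor=\lfloor x_j(k)\rfloor\ \text{ for all } i,j\in\mathcal{V},\qquad |x_i(k)-x_{ave}|<1\ \text{ for all } i\in\mathcal{V}.$$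
   Context: $\mathcal{V}=\{1,\dots,n\}$; $\mathcal{N}_i$ is the set of neighbors of $i$ in $\mathbb{G}$. Assumption A on $W=(w_{ij})\in\mathbb{R}^{n\times n}$: (i) $W$ is symmetric and doubly stochastic, i.e. $w_{ij}=w_{ji}\ge 0$ and $\sum_i w_{ij}=\sum_j w_{ij}=1$; (ii) $w_{ii}>1/2$ for all $i\in\mathcal{V}$; (iii) $w_{ij}=0$ whenever $i\neq j$ and $(i,j)\notin\mathcal{E}$; (iv) for every $(i,j)\in\mathcal{E}$, $w_{ij}$ is a rational number in $(0,1)$. Quantized system: starting from $\mathbf{x}(0)\in\mathbb{R}^n$, for $k=0,1,2,\dots$, $$\mathbf{x}(k+1)=W\lfloor\mathbf{x}(k)\rfloor+\mathbf{x}(k)-\lfloor\mathbf{x}(k)\rfloor,$$ where $\lfloor\cdot\rfloor$ acts componentwise; equivalently $x_i(k+1)=x_i(k)+\sum_{j\in\mathcal{N}_i}w_{ij}(\lfloor x_j(k)\rfloor-\lfloor x_i(k)\rfloor)$. The average is $x_{ave}=\frac1n\sum_{i\in\mathcal{V}}x_i(0)$. Constants: $c_i(k)=x_i(k)-\lfloor x_i(k)\rfloor$, $\bar c_i(k)=1-c_i(k)$. For the given $W$ and $\mathbf{x}(0)$, $\gamma>0$ is any fixed constant (one exists) such that for all $i\in\mathcal{V}$ and all $k\ge0$: if $c_i(k)>\sum_{j\in\mathcal{N}_i}w_{ij}$ then $c_i(k)-\sum_{j\in\mathcal{N}_i}w_{ij}\ge2\gamma$; if $\bar c_i(k)>\sum_{j\in\mathcal{N}_i}w_{ij}$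 then $\bar c_i(k)-\sum_{j\in\mathcal{N}_i}w_{ij}\ge2\gamma$; $\bar c_i(k)\ge2\gamma$; and $\frac12-\sum_{j\in\mathcal{N}_i}w_{ij}\ge2\gamma$. Set $\alpha_i=1-w_{ii}+\gamma$ and $\alpha=\max_{i\in\mathcal{V}}\alpha_i$. *)

(* Defs.v *)
From HB Require Import structures.
From mathcomp Require Import all_boot all_order all_algebra.
From mathcomp Require Import reals.

Set Implicit Arguments.
Unset Strict Implicit.
Unset Printing Implicit Defensive.

Import Order.TTheory GRing.Theory Num.Theory.
Local Open Scope ring_scope.

Record simple_graph (n : nat) (e : rel 'I_n) : Prop := SimpleGraph {
  graph_sym : symmetric e;
  graph_irrefl : irreflexive e
}.

Definition connected_graph (n : nat) (e : rel 'I_n) : Prop :=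
  forall i j : 'I_n, connect e i j.

Record assumptionA (R : realType) (n : nat) (e : rel 'I_n) (W : 'M[R]_n)
    : Prop := AssumptionA {
  W_sym : forall i j : 'I_n, W i j = W j i;
  W_ge0 : forall i j : 'I_n, 0 <= W i j;
  W_col_sum : forall j : 'I_n, \sum_(i < n) W i j = 1;
  W_row_sum : forall i : 'I_n, \sum_(j < n) W i j = 1;
  W_diag : forall i : 'I_n, 1 / 2 < W i i;
  W_off_edge : forall i j : 'I_n, i != j -> ~~ e i j -> W i j = 0;
  W_edge : forall i j : 'I_n, e i j ->
    (exists q : rat, W i j = ratr q) /\ 0 < W i j < 1
}.

Definition floor_vec (R : realType) (n : nat) (x : 'cV[R]_n) : 'cV[R]_n :=
  map_mx (fun t : R => (Num.floor t)%:~R) x.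

Fixpoint traj (R : realType) (n : nat) (W : 'M[R]_n) (x0 : 'cV[R]_n) (k : nat)
    : 'cV[R]_n :=
  if k is k'.+1 then
    let x := traj W x0 k' in W *m floor_vec x + x - floor_vec x
  else x0.

Definition average (R : realType) (n : nat) (x : 'cV[R]_n) : R :=
  (\sum_(i < n) x i 0) / n%:R.

Definition frac (R : realType) (t : R) : R := t - (Num.floor t)%:~R.

Definition cofrac (R : realType) (t : R) : R := 1 - frac t.

Definition nbr_weight (R : realType) (n : nat) (e : rel 'I_n) (W : 'M[R]_n)
    (i : 'I_n) : R :=
  \sum_(j < n | e i j) W i j.

Record gamma_admissible (R : realType) (n : nat) (e : rel 'I_n) (W : 'M[R]_n)
    (x0 : 'cV[R]_n) (gamma : R) : Prop := GammaAdmissible {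
  gamma_gt0 : 0 < gamma;
  gamma_frac : forall (i : 'I_n) (k : nat),
    nbr_weight e W i < frac (traj W x0 k i 0) ->
    2 * gamma <= frac (traj W x0 k i 0) - nbr_weight e W i;
  gamma_cofrac : forall (i : 'I_n) (k : nat),
    nbr_weight e W i < cofrac (traj W x0 k i 0) ->
    2 * gamma <= cofrac (traj W x0 k i 0) - nbr_weight e W i;
  gamma_cofrac_lb : forall (i : 'I_n) (k : nat),
    2 * gamma <= cofrac (traj W x0 k i 0);
  gamma_half : forall i : 'I_n, 2 * gamma <= 1 / 2 - nbr_weight e W i
}.

Definition alpha_at (R : realType) (n : nat) (W : 'M[R]_n) (gamma : R)
    (i : 'I_n) : R :=
  1 - W i i + gamma.

(* The default value 0 of the iterated maximum is harmless: a stochastic W has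
   W i i <= 1, so every alpha_at W gamma i is positive when gamma is. *)
Definition alpha_max (R : realType) (n : nat) (W : 'M[R]_n) (gamma : R) : R :=
  \big[Num.max/0]_(i < n) alpha_at W gamma i.

Definition cycling_from (R : realType) (n : nat) (W : 'M[R]_n)
    (x0 : 'cV[R]_n) (gamma : R) (k0 : nat) : Prop :=
  (exists P : nat, (1 <= P)%N /\
     forall k : nat, (k0 <= k)%N -> traj W x0 (k + P) = traj W x0 k) /\
  (forall k : nat, (k0 <= k)%N ->
     (forall i j : 'I_n,
        `|traj W x0 k i 0 - traj W x0 k j 0|
          <= alpha_at W gamma i + alpha_at W gamma j) /\
     (forall i : 'I_n,
        `|traj W x0 k i 0 - average x0| <= 2 * alpha_max W gamma)).

Definition quantized_consensus_from (R : realType) (n : nat) (W : 'M[R]_n)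
    (x0 : 'cV[R]_n) (k0 : nat) : Prop :=
  forall k : nat, (k0 <= k)%N ->
    (forall i j : 'I_n,
       Num.floor (traj W x0 k i 0) = Num.floor (traj W x0 k j 0)) /\
    (forall i : 'I_n, `|traj W x0 k i 0 - average x0| < 1).

(* Main.v *)
Require Import Defs.
From HB Require Import structures.
From mathcomp Require Import all_boot all_order all_algebra.
From mathcomp Require Import boolp reals.
From mathcomp Require Import zify lra.

Set Implicit Arguments.
Unset Strict Implicit.
Unset Printing Implicit Defensive.

Import Order.TTheory GRing.Theory Num.Theory.
Local Open Scope ring_scope.

(** Off-diagonal weights are rational with a common denominator [D], so [D]
times the displacement of each node stays an integer; the floors stay between
their initial minimum and maximum, so only finitely many states occur. The
dynamics being deterministic, the trajectory is eventually periodic, and along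
a periodic orbit every monotone quantity is constant.

Let [M] be the largest floor at some time of the periodic orbit. The [depth] of
a node is [M] minus its floor, its [excess] is [max (0, depth - 1)], and its
[shortfall] is the distance by which it lies below [M - alpha_i]. Write
[drift f i] for the sum over [j] of [W i j * (f j - f i)]; the dynamics is [x' = x - drift depth]. The key
inequality ([shortfall_step]) is
  [shortfall' <= shortfall + drift excess],
in which the last term sums to zero over the nodes since [W] is symmetric.
Hence the total shortfall is nonincreasing, thus constant, and the inequality
is an equality at every node and every time ([shortfall_flow]).

The choice of [gamma] then excludes that a node of zero shortfall acquires a
positive one ([shortfall_stuck]). A node of floor [M] has zero shortfall, so it
has zero shortfall forever and no neighbour of positive excess; a node that
never has positive excess cannot have such a neighbour either, and connectivity
shows that all floors are always [M] or [M - 1] ([excess_eq0]).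

Finally, a node whose floor is always [M], or always [M - 1], moves in one
direction only, hence not at all, so its neighbours have the same floor; by
connectivity this is quantized consensus ([pinned_consensus]). Otherwise each
node visits both floors. Having visited [M] it has zero shortfall, that is
[x_i >= M - alpha_i]; a node of floor below [M] jumps at most to
[M + 1 - W i i] and nodes of floor [M] never go up, so [x_i <= M + alpha_i].
The two bounds say that all nodes lie around the same integer [M], and the
estimates around the average follow since the average is conserved. *)

(** * Connected graphs and periodic sequences *)

Lemma connected_ind n (e : rel 'I_n) (Q : 'I_n -> Prop) :
  connected_graph e -> (forall i j, e i j -> Q i -> Q j) ->
  forall i, Q i -> forall j, Q j.
Proof.
move=> conn ind i Qi j; have /connectP[p + ->] := conn i j.
elim: p i Qi => [|a p IHp] i Qi //= /andP[eia pp].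
exact: IHp (ind _ _ eia Qi) pp.
Qed.

Section PeriodicSequences.
Variables (T : Type) (y : nat -> T) (P : nat).
Hypothesis P_gt0 : (0 < P)%N.
Hypothesis yP : forall k, y (k + P) = y k.

Lemma periodic_mul k l : y (k + l * P) = y k.
Proof.
by elim: l => [|l IHl]; rewrite ?mul0n ?addn0 // mulSnr addnA yP.
Qed.

(** Every time is congruent, modulo the period, to a time after [k1]. *)
Lemma periodic_invariant (Q : T -> Prop) k1 :
  (forall k, Q (y k) -> Q (y k.+1)) -> Q (y k1) -> forall k, Q (y k).
Proof.
move=> QS Qk1 k; rewrite -(periodic_mul k k1).
have : (k1 <= k + k1 * P)%N by rewrite (leq_trans (leq_pmulr k1 P_gt0)) ?leq_addl.
elim: (k + _)%N => [|l IHl]; first by rewrite leqn0 => /eqP <-.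
by rewrite leq_eqVlt => /predU1P[<- //|/IHl/QS].
Qed.

Lemma periodic_nondecr_const (R : realDomainType) (f : T -> R) :
  (forall k, f (y k) <= f (y k.+1)) -> forall k, f (y k.+1) = f (y k).
Proof.
move=> fS k; apply/eqP; rewrite eq_le fS andbT.
by apply: (@periodic_invariant (fun z => f (y k.+1) <= f z) k.+1) => // l /le_trans->.
Qed.
End PeriodicSequences.

(** * The weighted Laplacian *)

Section Drift.
Variables (R : realType) (n : nat) (e : rel 'I_n) (W : 'M[R]_n).
Hypothesis hW : assumptionA e W.

(** The Laplacian of the weighted graph; it is both the velocity of the
dynamics, when applied to the floors, and the flow that bounds the Lyapunov
function. *)
Definition drift (f : 'I_n -> R) (i : 'I_n) : R := \sum_j W i j * (f j - f i).

Lemma driftD f g i : drift (fun j => f j + g j) i = drift f i + drift g i.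
Proof. by rewrite -big_split; apply: eq_bigr => j _ /=; lra. Qed.

Lemma driftZ a f i : drift (fun j => a * f j) i = a * drift f i.
Proof. by rewrite mulr_sumr; apply: eq_bigr => j _; lra. Qed.

(** Opposite contributions of [(i, j)] and [(j, i)], as [W] is symmetric. *)
Lemma sum_drift f : \sum_i drift f i = 0.
Proof.
have: \sum_i drift f i = - \sum_i drift f i; last by lra.
rewrite {1}exchange_big -sumrN; apply: eq_bigr => i _.
rewrite -sumrN; apply: eq_bigr => j _; rewrite (W_sym hW j i); lra.
Qed.

(** The diagonal term of the drift vanishes, so only the mass [1 - W i i] of the
neighbours counts. *)
Lemma drift_ge f c i : 0 <= c -> (forall j, f i - c <= f j) ->
  - (c * (1 - W i i)) <= drift f i.
Proof.
move=> c0 fc.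
have -> : 1 - W i i = \sum_(j | j != i) W i j.
  by rewrite -(W_row_sum hW i) (bigD1 i) //= addrAC subrr add0r.
rewrite /drift [leRHS](bigD1 i) //= subrr mulr0 add0r.
rewrite mulr_sumr -sumrN ler_sum // => j _.
have := W_ge0 hW i j; have := fc j; nra.
Qed.

Lemma drift_ge0 f i : (forall j, f i <= f j) -> 0 <= drift f i.
Proof.
by move=> fi; rewrite sumr_ge0 // => j _; rewrite mulr_ge0 ?(W_ge0 hW) ?subr_ge0.
Qed.

(** Minimum principle: a sum of nonnegative terms vanishes termwise, and the
weight of an edge is positive. *)
Lemma drift_eq0 f i j : (forall l, f i <= f l) -> drift f i = 0 -> e i j ->
  f j = f i.
Proof.
move=> fi /psumr_eq0P f0 /(W_edge hW)[_ /andP[Wij _]].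
have nneg l : true -> 0 <= W i l * (f l - f i).
  by move=> _; rewrite mulr_ge0 ?(W_ge0 hW) // subr_ge0.
by have /eqP := f0 nneg j isT; rewrite mulf_eq0 gt_eqF //= subr_eq0 => /eqP.
Qed.
End Drift.

(** * One step of the quantized dynamics *)

Definition level (R : realType) n (x : 'cV[R]_n) (i : 'I_n) : int :=
  Num.floor (x i 0).

Definition step (R : realType) n (W : 'M[R]_n) (x : 'cV[R]_n) : 'cV[R]_n :=
  W *m floor_vec x + x - floor_vec x.

Section Step.
Variables (R : realType) (n : nat) (e : rel 'I_n) (W : 'M[R]_n).
Hypothesis hW : assumptionA e W.

Lemma stepE x i :
  step W x i 0 = x i 0 + drift W (fun j => (level x j)%:~R) i.
Proof.
rewrite !mxE /drift.
under [in RHS]eq_bigr do rewrite mulrBr.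
rewrite sumrB -mulr_suml (W_row_sum hW) mul1r addrAC [RHS]addrC.
by congr (_ - _ + _); apply: eq_bigr => j _; rewrite mxE.
Qed.

Lemma sum_step x : \sum_i step W x i 0 = \sum_i x i 0.
Proof.
under eq_bigr do rewrite stepE.
by rewrite big_split /= (sum_drift hW) addr0.
Qed.

Lemma level_le (x : 'cV[R]_n) i : (level x i)%:~R <= x i 0.
Proof. exact: floor_le. Qed.

Lemma level_gt (x : 'cV[R]_n) i : x i 0 < (level x i)%:~R + 1.
Proof. by have := floor_itv (x i 0); rewrite intrD => /andP[]. Qed.

Lemma offdiag_ge0 i : 0 <= 1 - W i i.
Proof.
rewrite -(W_row_sum hW i) (bigD1 i) //= addrAC subrr add0r sumr_ge0 // => j _.
exact: W_ge0 hW _ _.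
Qed.

(** A step replaces the floor part of [x i] by an average of floors and keeps its
fractional part, so the range of the floors cannot grow. *)
Lemma level_step_ge (m : int) x : (forall j, m <= level x j) ->
  forall i, m <= level (step W x) i.
Proof.
move=> mx i; rewrite /level floor_ge_int stepE.
have mxR j : m%:~R <= (level x j)%:~R :> R by rewrite ler_int.
have := @drift_ge _ _ _ _ hW (fun j => (level x j)%:~R)
  ((level x i)%:~R - m%:~R) i.
rewrite subr_ge0 mxR opprB addrCA subrr addr0 => /(_ isT mxR) H.
by have := mxR i; have := level_le x i; have := W_diag hW i; nra.
Qed.

Lemma step_le (M : int) x i : (forall j, level x j <= M) ->
  step W x i 0 <= x i 0 + (M%:~R - (level x i)%:~R) * (1 - W i i).
Proof.
move=> xM; have xMR j : (level x j)%:~R <= M%:~R :> R by rewrite ler_int.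
rewrite stepE; have := @drift_ge _ _ _ _ hW (fun j => -1 * (level x j)%:~R)
  (M%:~R - (level x i)%:~R) i.
rewrite driftZ subr_ge0 xMR => /(_ isT) H.
have {}H := H (fun j => _).
suff: - ((M%:~R - (level x i)%:~R) * (1 - W i i)) <=
   -1 * drift W (fun j => (level x j)%:~R) i by lra.
by apply: H => j; have := xMR j; lra.
Qed.

Lemma level_step_le (M : int) x : (forall j, level x j <= M) ->
  forall i, level (step W x) i <= M.
Proof.
move=> xM i; rewrite -ltzD1 /level floor_lt_int intrD.
have xMR : (level x i)%:~R <= M%:~R :> R by rewrite ler_int.
have := step_le i xM; have := level_gt x i; have := W_diag hW i.
by have := offdiag_ge0 i; nra.
Qed.
End Step.

(** * The Lyapunov function *)

Definition depth (R : realType) n (M : int) (x : 'cV[R]_n) (i : 'I_n) : R :=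
  (M - level x i)%:~R.

Definition excess (R : realType) n (M : int) (x : 'cV[R]_n) (i : 'I_n) : R :=
  Num.max 0 (depth M x i - 1).

Definition shortfall (R : realType) n (W : 'M[R]_n) (gamma : R) (M : int)
    (x : 'cV[R]_n) (i : 'I_n) : R :=
  Num.max 0 (M%:~R - x i 0 - alpha_at W gamma i).

Section Lyapunov.
Variables (R : realType) (n : nat) (e : rel 'I_n) (W : 'M[R]_n).
Variables (gamma : R) (M : int).

Variant depth_spec (x : 'cV[R]_n) (i : 'I_n) : R -> R -> Prop :=
| DepthTop of level x i = M : depth_spec x i 0 0
| DepthOne of level x i < M : depth_spec x i 1 0
| DepthBig (d : R) of level x i < M & 2 <= d : depth_spec x i d (d - 1).

Lemma depthP x i : level x i <= M -> depth_spec x i (depth M x i) (excess M x i).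
Proof.
move=> leM; rewrite /excess /depth.
have: 0 <= M - level x i by rewrite subr_ge0.
rewrite le_eqVlt => /predU1P[H|].
  by rewrite -H mulr0z sub0r max_l ?oppr_le0 ?ler01 //; apply: DepthTop; lia.
rewrite gtz0_ge1 le_eqVlt => /predU1P[H|].
  by rewrite -H subrr maxxx; apply: DepthOne; lia.
rewrite -lezD1 => H; have H2 : 2 <= (M - level x i)%:~R :> R by rewrite (ler_int R 2).
by rewrite max_r; [apply: DepthBig => //; lia|lra].
Qed.

Lemma shortfall_ge0 x i : 0 <= shortfall W gamma M x i.
Proof. by rewrite le_max lexx. Qed.

Lemma shortfall_ge (x : 'cV[R]_n) i :
  M%:~R - x i 0 - alpha_at W gamma i <= shortfall W gamma M x i.
Proof. by rewrite le_max lexx orbT. Qed.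

Hypothesis hW : assumptionA e W.

Lemma step_depth x i : step W x i 0 = x i 0 - drift W (depth M x) i.
Proof.
rewrite (stepE hW) -mulN1r -driftZ; congr (_ + _); apply: eq_bigr => j _.
by rewrite /depth !intrB; lra.
Qed.

(** The difference [excess - depth] is [0] on floor [M] and [-1] below: its drift
is nonnegative at a node of floor below [M] and at least [- (1 - W i i)] at any
node. *)
Lemma shortfall_drift x i : (forall j, level x j <= M) ->
  [/\ - (excess M x i * (1 - W i i)) <= drift W (excess M x) i,
      (level x i < M -> drift W (depth M x) i <= drift W (excess M x) i)
    & drift W (depth M x) i - (1 - W i i) <= drift W (excess M x) i].
Proof.
move=> xM.
have E0 j : 0 <= excess M x j by rewrite le_max lexx.
pose r j := excess M x j + -1 * depth M x j.
have rE : drift W (excess M x) i - drift W (depth M x) i = drift W r i.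
  by rewrite /r driftD driftZ; lra.
have rr j : [/\ -1 <= r j, r j <= 0 & level x j < M -> r j = -1].
  rewrite /r; case: (depthP (xM j)) => [->|_|d _ _]; split=> //; try lra.
  by rewrite ltxx.
split.
- by apply: (drift_ge hW) => // j; rewrite subrr.
- move=> iM; rewrite -subr_ge0 rE.
  by apply: (drift_ge0 hW) => j; have [_ _ /(_ iM)->] := rr i; have [] := rr j; lra.
- have := @drift_ge _ _ _ _ hW r 1 i ler01; rewrite mul1r -rE => H.
  suff: - (1 - W i i) <= drift W (excess M x) i - drift W (depth M x) i by lra.
  by apply: H => j; have [_ + _] := rr i; have [] := rr j; lra.
Qed.

Hypothesis gamma_gt0 : 0 < gamma.
Hypothesis gamma_diag : forall i, 2 * gamma <= 1 / 2 - (1 - W i i).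

(** A node of floor [M] has shortfall zero and margin [alpha_i], which absorbs the
loss [1 - W i i] of the previous lemma; a node below [M] loses at most as much
height as excess flows into it. The bound could only fail for a node of depth
[d >= 2] whose outflow of excess exceeds its shortfall; this outflow is at most
[(d - 1) * (1 - W i i)], which is less than the shortfall as [1 - W i i]
stays below [1 / 2] by a multiple of [gamma]. *)
Lemma shortfall_step x i : (forall j, level x j <= M) ->
  shortfall W gamma M (step W x) i <=
    shortfall W gamma M x i + drift W (excess M x) i.
Proof.
move=> xM; have [lbE leE leE'] := shortfall_drift i xM.
have p0 := shortfall_ge0 x i; have pu := shortfall_ge x i.
have dE : depth M x i = M%:~R - (level x i)%:~R by exact: intrB.
have xl := level_le x i; have xg := level_gt x i; have g := gamma_diag i.
have Wd := W_diag hW i; have S0 := offdiag_ge0 hW i; have g0 := gamma_gt0.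
suff [pE uE] : 0 <= shortfall W gamma M x i + drift W (excess M x) i /\
    M%:~R - step W x i 0 - alpha_at W gamma i <=
      shortfall W gamma M x i + drift W (excess M x) i.
  by rewrite {1}/shortfall ge_max pE.
rewrite step_depth; move: dE pu lbE leE leE'; rewrite /alpha_at.
case: (depthP (xM i)).
- by move=> _ dE pu lbE _ leE'; split; lra.
- by move=> iM dE pu lbE /(_ iM) leE _; split; lra.
- move=> d iM d2 dE pu lbE /(_ iM) leE _; split; last by lra.
  (* as 1 - W i i <= 1 / 2 - 2 gamma, d (1 - W i i) <= d - 1 - 4 gamma *)
  by nra.
Qed.

(** If the bound of [shortfall_step] is attained at a node of zero shortfall, a
positive drift would require a node of depth [1] placed exactly at
[M - alpha_i], hence with [cofrac] equal to [1 - W i i + gamma]. The gap in the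
possible values of [cofrac] excludes this. *)
Lemma shortfall_stuck x i : (forall j, level x j <= M) ->
  (1 - W i i < cofrac (x i 0) -> 2 * gamma <= cofrac (x i 0) - (1 - W i i)) ->
  shortfall W gamma M x i = 0 ->
  shortfall W gamma M (step W x) i = drift W (excess M x) i ->
  drift W (excess M x) i = 0.
Proof.
move=> xM gap sh0; have [lbE leE leE'] := shortfall_drift i xM.
have := shortfall_ge x i; rewrite sh0 => u0.
have dE : depth M x i = M%:~R - (level x i)%:~R by exact: intrB.
have xl := level_le x i; have xg := level_gt x i; have g := gamma_diag i.
have Wd := W_diag hW i; have S0 := offdiag_ge0 hW i; have g0 := gamma_gt0.
rewrite /shortfall step_depth.
have [v0|v0] := lerP (M%:~R - (x i 0 - drift W (depth M x) i) -
  alpha_at W gamma i) 0; first by [].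
move=> shE; move: v0 shE u0.
move: dE lbE leE leE'; rewrite /alpha_at; case: (depthP (xM i)).
- move=> _ dE lbE _ leE' v0 shE u0; lra.
- move=> iM dE lbE /(_ iM) leE _ v0 shE u0.
  (* attaining the bound without truncation at 0 leaves only the value
     cofrac (x i 0) = 1 - W i i + gamma *)
  have cE : cofrac (x i 0) = M%:~R - x i 0
    by rewrite [LHS](_ : _ = 1 - (x i 0 - (level x i)%:~R)) //; lra.
  have [|/gap gapE] := lerP (cofrac (x i 0)) (1 - W i i); lra.
- move=> d iM d2 dE _ _ _ _ _ u0; exfalso; lra.
Qed.
End Lyapunov.

(** * Periodic orbits *)

Section PeriodicOrbit.
Variables (R : realType) (n : nat) (e : rel 'I_n) (W : 'M[R]_n).
Variables (gamma : R) (M : int) (y : nat -> 'cV[R]_n) (P : nat).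
Hypothesis hconn : connected_graph e.
Hypothesis hW : assumptionA e W.
Hypothesis P_gt0 : (0 < P)%N.
Hypothesis yP : forall k, y (k + P) = y k.
Hypothesis yS : forall k, y k.+1 = step W (y k).

(** A node whose floor is always extremal moves monotonically, hence by
periodicity stays still, which forces its neighbours to have the same floor; so
they are extremal too. The sign of [s] selects minimal or maximal floors. *)
Lemma pinned_consensus (s : R) i : s != 0 ->
  (forall k j, s * (level (y k) i)%:~R <= s * (level (y k) j)%:~R) ->
  forall k j, level (y k) j = level (y k) i.
Proof.
move=> s0 imin k j; suff Qj : forall k l,
    s * (level (y k) j)%:~R <= s * (level (y k) l)%:~R.
  apply/eqP; rewrite -(eqr_int R); apply/eqP/(mulfI s0)/le_anti.
  by rewrite Qj imin.
move: j; apply: (connected_ind hconn _ imin) => {imin k} i' j eij imin.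
suff Lij k : level (y k) j = level (y k) i' by move=> k l; rewrite Lij.
have dr k' : 0 <= s * drift W (fun l => (level (y k') l)%:~R) i'.
  by rewrite -driftZ; apply: (drift_ge0 hW) => l; apply: imin.
have yE k' : s * y k'.+1 i' 0 =
    s * y k' i' 0 + s * drift W (fun l => (level (y k') l)%:~R) i'.
  by rewrite yS (stepE hW) mulrDr.
have := periodic_nondecr_const P_gt0 yP (f := fun x => s * x i' 0) _ k.
rewrite yE => H; apply/eqP; rewrite -(eqr_int R); apply/eqP/(mulfI s0).
apply: (drift_eq0 hW (f := fun l => s * (level (y k) l)%:~R)) eij => //.
rewrite driftZ; apply: (addrI (s * y k i' 0)); rewrite addr0; apply: H => k'.
by rewrite yE lerDl.
Qed.

Hypothesis gamma_gt0 : 0 < gamma.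
Hypothesis gamma_diag : forall i, 2 * gamma <= 1 / 2 - (1 - W i i).
Hypothesis gamma_gap : forall k i, 1 - W i i < cofrac (y k i 0) ->
  2 * gamma <= cofrac (y k i 0) - (1 - W i i).
Hypothesis yM : forall k i, level (y k) i <= M.

(** The total shortfall is nonincreasing and periodic, so the inequalities of
[shortfall_step] have total slack zero. *)
Lemma shortfall_flow k i :
  shortfall W gamma M (y k.+1) i =
    shortfall W gamma M (y k) i + drift W (excess M (y k)) i.
Proof.
have le_flow k' i' := shortfall_step hW gamma_gt0 gamma_diag i' (yM k').
pose V x := - \sum_i shortfall W gamma M x i.
have VS k' : V (y k') <= V (y k'.+1).
  have := ler_sum (index_enum _) (fun j (_ : xpredT j) => le_flow k' j).
  by rewrite lerN2 big_split /= (sum_drift hW) addr0 yS.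
have := periodic_nondecr_const P_gt0 yP VS k => /oppr_inj VE.
pose slack j := shortfall W gamma M (y k) j + drift W (excess M (y k)) j -
  shortfall W gamma M (y k.+1) j.
suff slack0 : slack i = 0 by apply/esym/eqP; rewrite -subr_eq0; apply/eqP.
apply: (@psumr_eq0P _ _ predT slack) => // [j _|].
  by rewrite subr_ge0 yS.
by rewrite sumrB big_split /= (sum_drift hW) addr0 VE subrr.
Qed.

Lemma shortfall_eq0_top k1 i : level (y k1) i = M ->
  forall k, shortfall W gamma M (y k) i = 0.
Proof.
move=> top; apply: (@periodic_invariant _ y P P_gt0 yP
  (fun x => shortfall W gamma M x i = 0) k1) => [k sf0|].
  have := shortfall_flow k i; rewrite sf0 add0r => flow; rewrite flow.
  apply: (shortfall_stuck hW gamma_gt0 gamma_diag (yM k) (@gamma_gap k i) sf0).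
  by rewrite -yS.
rewrite /shortfall max_l // /alpha_at.
have := level_le (y k1) i; rewrite top; have := offdiag_ge0 hW i.
have := gamma_gt0; lra.
Qed.

(** A node that never has positive excess receives a nonnegative flow of excess,
so its shortfall is nondecreasing, hence constant: the flow vanishes, and by the
minimum principle its neighbours have no excess either. *)
Lemma excess_eq0 i0 : level (y 0) i0 = M -> forall i k, excess M (y k) i = 0.
Proof.
move=> top; apply: (connected_ind hconn (Q := fun i => forall k, excess M (y k) i = 0)
  _ (i := i0)) => [i j eij Ei k|k].
  have Emin k' l : excess M (y k') i <= excess M (y k') l.
    by rewrite Ei le_max lexx.
  have sfS k' : shortfall W gamma M (y k') i <= shortfall W gamma M (y k'.+1) i.
    by rewrite shortfall_flow lerDl; apply: (drift_ge0 hW).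
  rewrite -(Ei k); apply: (drift_eq0 hW (Emin k)) eij.
  apply: (addrI (shortfall W gamma M (y k) i)); rewrite addr0 -shortfall_flow.
  exact: (periodic_nondecr_const P_gt0 yP (f := fun x => shortfall W gamma M x i)).
have := shortfall_eq0_top top k => sf0; have := shortfall_ge W gamma M (y k) i0.
have dE : depth M (y k) i0 = M%:~R - (level (y k) i0)%:~R by exact: intrB.
have xg := level_gt (y k) i0; have g := gamma_diag i0; have g0 := gamma_gt0.
rewrite sf0 /alpha_at; move: dE; case: (depthP (yM k i0)) => // d _ d2 dE u0.
by lra.
Qed.

(** Coming from a floor below [M], a node reaches at most [M + (1 - W i i)]; at
floor [M] it can only go down. *)
Lemma upper_band k1 i : level (y k1) i < M ->
  forall k, y k i 0 <= M%:~R + (1 - W i i).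
Proof.
have Wd := W_diag hW i; have S0 := offdiag_ge0 hW i => low.
have below_step k : level (y k) i < M ->
    step W (y k) i 0 <= M%:~R + (1 - W i i).
  rewrite -lezD1 -(ler_int R) intrD => lowk.
  by have := step_le hW i (yM k); have := level_gt (y k) i; nra.
apply: (@periodic_invariant _ y P P_gt0 yP
  (fun x => x i 0 <= M%:~R + (1 - W i i)) k1.+1) => [k|]; rewrite yS.
  case: (eqVneq (level (y k) i) M) => [topk|].
    by apply: le_trans; have := step_le hW i (yM k); rewrite topk subrr mul0r addr0.
  have := yM k i; rewrite le_eqVlt => /orP[->//|lowk _ _].
  exact: below_step.
exact: below_step.
Qed.

(** Either some node has always floor [M] or always a floor below [M], hence
[M - 1], and it is pinned at an extremal floor; or every node visits both sides
of [M], and each visit gives one of the two bounds forever. *)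
Lemma orbit_dichotomy i0 : level (y 0) i0 = M ->
  (forall k i j, level (y k) i = level (y k) j) \/
  (forall k i, `|y k i 0 - M%:~R| <= alpha_at W gamma i).
Proof.
move=> top.
have [[i pin]|npin] := pselect (exists i,
  (forall k, level (y k) i = M) \/ (forall k, level (y k) i < M)).
  left; suff H k j : level (y k) j = level (y k) i by move=> k j l; rewrite !H.
  case: pin => pin.
    apply: (@pinned_consensus (-1)) => [|k' l]; first by rewrite oppr_eq0 oner_eq0.
    by rewrite !mulN1r lerN2 ler_int pin yM.
  apply: (@pinned_consensus 1) => [|k' l]; first exact: oner_neq0.
  rewrite !mul1r ler_int.
  suff : M - 1 <= level (y k') l by have := pin k'; lia.
  have := excess_eq0 top l k'; rewrite /excess /depth.
  have [H _|] := lerP ((M - level (y k') l)%:~R - 1) (0 : R); last by move=> /gt_eqF/eqP.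
  by move: H; rewrite subr_le0 (ler_int R _ 1); lia.
right=> k i.
have [k1 low] : exists k, level (y k) i < M.
  apply: contrapT => nlow; apply: npin; exists i; left=> l.
  by apply/eqP; rewrite eq_le yM /= leNgt; apply/negP => ?; apply: nlow; exists l.
have [k2 high] : exists k, level (y k) i = M.
  apply: contrapT => nhigh; apply: npin; exists i; right=> l.
  by rewrite lt_neqAle yM andbT; apply/eqP => ?; apply: nhigh; exists l.
have := upper_band low k; have := shortfall_ge W gamma M (y k) i.
rewrite (shortfall_eq0_top high) /alpha_at ler_norml => lo hi.
by have g0 := gamma_gt0; apply/andP; split; lra.
Qed.
End PeriodicOrbit.

(** * Eventual periodicity of the trajectory *)

Lemma common_denominator (R : realType) (I : finType) (f : I -> R) :
  (forall i, exists q : rat, f i = ratr q) ->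
  exists2 D : nat, (0 < D)%N & forall i, D%:R * f i \is a Num.int.
Proof.
move=> /fin_all_exists[q fq].
exists (\prod_i `|denq (q i)|%N)%N; first by rewrite prodn_gt0 // => i; rewrite absz_gt0.
move=> i; rewrite (bigD1 i) //= mulnC natrM -mulrA fq.
apply: rpredM; first exact: rpred_nat.
suff -> : (`|denq (q i)|%N)%:R * ratr (q i) = (numq (q i))%:~R :> R by exact: intr_int.
have -> : (`|denq (q i)|%N)%:R = ratr (denq (q i))%:~R :> R.
  by rewrite ratr_int pmulrn absz_denq.
by rewrite -[RHS]ratr_int numqE [RHS]rmorphM mulrC.
Qed.

(** The scaled displacements are vectors of integers of absolute value at most
[B], encoded by a shift as elements of ['I_(2 * B + 1)]. *)
Lemma bounded_lattice_pigeonhole (R : realType) n (x0 : 'cV[R]_n)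
    (y : nat -> 'cV[R]_n) (D B : nat) : (0 < D)%N ->
  (forall k i, D%:R * (y k i 0 - x0 i 0) \is a Num.int) ->
  (forall k i, `|D%:R * (y k i 0 - x0 i 0)| <= B%:R) ->
  exists k P, (0 < P)%N /\ y (k + P)%N = y k.
Proof.
move=> D0 yZ yB.
have [z zE] : exists z : nat -> 'I_n -> int,
    forall k i, D%:R * (y k i 0 - x0 i 0) = (z k i)%:~R.
  by exists (fun k i => Num.floor (D%:R * (y k i 0 - x0 i 0))) => k i; rewrite floorK.
have zB k i : `|z k i| <= B by have := yB k i; rewrite zE -intr_norm pmulrn ler_int.
pose code k : {ffun 'I_n -> 'I_(B + B).+1} := [ffun i => inord (absz (z k i + B%:Z))].
have: ~~ injectiveb (fun k : 'I_#|{: {ffun 'I_n -> 'I_(B + B).+1}}|.+1 => code k).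
  by apply/injectiveP => /leq_card; rewrite card_ord ltnn.
case/injectivePn => [[k1 lt1] [[k2 lt2] + /= Ek]].
rewrite -(inj_eq val_inj) /= => k12 {lt1 lt2}.
wlog lt12 : k1 k2 k12 Ek / (k1 < k2)%N.
  move=> H; have := k12; rewrite neq_ltn => /orP[|lt21]; first exact: H.
  by apply: (H k2 k1) => //; rewrite eq_sym.
exists k1, (k2 - k1)%N; rewrite subn_gt0 subnKC ?(ltnW lt12) //; split=> //.
apply/colP => i; apply: (addIr (- x0 i 0)).
have D0R : D%:R != 0 :> R by rewrite pnatr_eq0 -lt0n.
apply: (mulfI D0R); rewrite !zE; congr (_%:~R).
have /ffunP/(_ i) := Ek; rewrite !ffunE => /(congr1 (@nat_of_ord _)); rewrite !inordK.
- by have := zB k1 i; have := zB k2 i; lia.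
- by have := zB k2 i; lia.
- by have := zB k1 i; lia.
Qed.

Section Trajectory.
Variables (R : realType) (n : nat) (e : rel 'I_n) (W : 'M[R]_n).
Variables (x0 : 'cV[R]_n).
Hypothesis hW : assumptionA e W.

Lemma trajS k : traj W x0 k.+1 = step W (traj W x0 k).
Proof. by []. Qed.

(** Only off-diagonal weights matter, since a node exerts no pull on itself. *)
Lemma traj_lattice D :
  (forall i j, i != j -> D%:R * W i j \is a Num.int) ->
  forall k i, D%:R * (traj W x0 k i 0 - x0 i 0) \is a Num.int.
Proof.
move=> DW; elim=> [|k IHk] i; first by rewrite subrr mulr0.
rewrite trajS (stepE hW) addrAC mulrDr; apply: rpredD (IHk i) _.
rewrite mulr_sumr; apply: rpred_sum => j _.
have [->|ij] := eqVneq i j; first by rewrite subrr !mulr0 rpred0.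
by rewrite mulrA rpredM ?DW // rpredB ?intr_int.
Qed.

Lemma offdiag_denominator :
  exists2 D : nat, (0 < D)%N & forall i j, i != j -> D%:R * W i j \is a Num.int.
Proof.
have [|D D0 HD] := @common_denominator R ('I_n * 'I_n)%type
    (fun p => if p.1 == p.2 then 0 else W p.1 p.2).
  move=> [i j] /=; case: eqVneq => [_|ij]; first by exists 0; rewrite rmorph0.
  have [/(W_edge hW)[]//|/(W_off_edge hW ij)->] := boolP (e i j).
  by exists 0; rewrite rmorph0.
by exists D => // i j /negPf ij; have := HD (i, j); rewrite /= ij.
Qed.

Lemma level_bound : exists C : nat,
  forall k i, - C%:Z <= level (traj W x0 k) i <= C%:Z.
Proof.
have [C x0C] : exists C : nat, forall i, (`|level x0 i| <= C)%N.
  by exists (\sum_i `|level x0 i|)%N => i; rewrite (bigD1 i) //= leq_addr.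
exists C; suff H k : (forall i, - C%:Z <= level (traj W x0 k) i) /\
    (forall i, level (traj W x0 k) i <= C%:Z).
  by move=> k i; have [lo hi] := H k; rewrite lo hi.
elim: k => [|k [lo hi]]; first by split=> i; have := x0C i; rewrite /=; lia.
by split=> i; rewrite trajS; [apply: (level_step_ge hW)|apply: (level_step_le hW)].
Qed.

Lemma traj_eventually_periodic : exists k0 P, (0 < P)%N /\
  forall k, traj W x0 (k0 + k + P) = traj W x0 (k0 + k).
Proof.
have [D D0 /traj_lattice DZ] := offdiag_denominator.
have [C levC] := level_bound.
have [|k0 [P [P0 EP]]] := bounded_lattice_pigeonhole (B := (D * (C + C + 1))%N) D0 DZ.
  move=> k i; rewrite normrM normr_nat natrM ler_wpM2l ?ler0n //.
  have inC k' : - C%:R <= traj W x0 k' i 0 <= C%:R + 1.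
    have := level_le (traj W x0 k') i; have := level_gt (traj W x0 k') i.
    have := levC k' i; rewrite -!(ler_int R) intrN -pmulrn => /andP[? ?] ? ?.
    by apply/andP; split; lra.
  have /andP[? ?] := inC k; have /andP[? ?] := inC 0%N.
  by rewrite ler_norml !natrD; apply/andP; split; lra.
exists k0, P; split=> //; elim=> [|k IHk]; first by rewrite addn0.
by rewrite addnS addSn !trajS IHk.
Qed.

Lemma traj_average k : average (traj W x0 k) = average x0.
Proof.
by elim: k => // k <-; rewrite trajS /average (sum_step hW).
Qed.
End Trajectory.

(** * Averages *)

Section Average.
Variables (R : realType) (n : nat) (x : 'cV[R]_n).
Hypothesis n_gt0 : (0 < n)%N.

Lemma sum_sub_average c : \sum_i (x i 0 - c) = n%:R * (average x - c).
Proof.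
rewrite sumrB sumr_const card_ord mulrBr [average x]mulrC mulVKf ?mulr_natl //.
by rewrite pnatr_eq0 -lt0n.
Qed.

Lemma average_ge c : (forall i, c <= x i 0) -> c <= average x.
Proof.
move=> xc; rewrite -subr_ge0 -(pmulr_rge0 _ (_ : 0 < n%:R)) ?ltr0n //.
by rewrite -sum_sub_average sumr_ge0 // => i _; rewrite subr_ge0.
Qed.

Lemma average_le c : (forall i, x i 0 <= c) -> average x <= c.
Proof.
move=> xc; rewrite -subr_le0 -(pmulr_rle0 _ (_ : 0 < n%:R)) ?ltr0n //.
by rewrite -sum_sub_average sumr_le0 // => i _; rewrite subr_le0.
Qed.

Lemma average_lt c : (forall i, x i 0 < c) -> average x < c.
Proof.
move=> xc; rewrite -subr_lt0 -(pmulr_rlt0 _ (_ : 0 < n%:R)) ?ltr0n //.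
rewrite -sum_sub_average (bigD1 (Ordinal n_gt0)) //= ltr_wnDr ?subr_lt0 //.
by rewrite sumr_le0 // => i _; rewrite subr_le0 ltW.
Qed.
End Average.

Lemma nbr_weight_diag (R : realType) n (e : rel 'I_n) (W : 'M[R]_n) i :
  simple_graph e -> assumptionA e W -> nbr_weight e W i = 1 - W i i.
Proof.
move=> he hW; rewrite -(W_row_sum hW i) (bigD1 i) //= addrAC subrr add0r.
rewrite /nbr_weight [RHS](bigID (e i)) /= [X in _ = _ + X]big1 ?addr0 => [|j].
  apply: eq_bigl => j; case: eqVneq => [->|//]; exact: graph_irrefl he i.
by case/andP=> ji; apply: (W_off_edge hW); rewrite eq_sym.
Qed.

(** * The dichotomy *)

Theorem proposition4 (R : realType) (n : nat) (e : rel 'I_n) (W : 'M[R]_n)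
    (hn : (1 < n)%N) (he : simple_graph e) (hconn : connected_graph e)
    (hW : assumptionA e W) (x0 : 'cV[R]_n) (gamma : R)
    (hgamma : gamma_admissible e W x0 gamma) :
  exists k0 : nat,
    cycling_from W x0 gamma k0 \/ quantized_consensus_from W x0 k0.
Proof.
have n0 : (0 < n)%N := ltnW hn.
have [k0 [P [P0 EP]]] := traj_eventually_periodic x0 hW.
pose y k := traj W x0 (k0 + k).
have yE k : (k0 <= k)%N -> traj W x0 k = y (k - k0)%N by move=> ?; rewrite /y subnKC.
have yS k : y k.+1 = step W (y k) by rewrite /y addnS.
have yP k : y (k + P)%N = y k by rewrite /y addnA.
have [i0 _ top] := arg_maxP (P := predT) (level (y 0%N)) (erefl : predT (Ordinal n0)).
set M := level (y 0%N) i0 in top.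
have yM k i : level (y k) i <= M.
  elim: k i => [|k IHk] i; first exact: top.
  by rewrite yS; apply: (level_step_le hW).
have gdiag i : 2 * gamma <= 1 / 2 - (1 - W i i).
  by have := gamma_half hgamma i; rewrite nbr_weight_diag.
have ggap k i : 1 - W i i < cofrac (y k i 0) ->
    2 * gamma <= cofrac (y k i 0) - (1 - W i i).
  by have := @gamma_cofrac _ _ _ _ _ _ hgamma i (k0 + k)%N; rewrite nbr_weight_diag.
exists k0; have [cons|band] :=
  orbit_dichotomy hconn hW P0 yP yS (gamma_gt0 hgamma) gdiag ggap yM (erefl M).
- right=> k k0k; rewrite (yE k k0k); split=> [|i]; first exact: cons.
  rewrite -(traj_average x0 hW k) (yE k k0k) -/(y _); set x := y _.
  have lo : (level x i)%:~R <= average x.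
    by apply: average_ge => // j; rewrite (cons _ i j) level_le.
  have hi : average x < (level x i)%:~R + 1.
    by apply: average_lt => // j; rewrite (cons _ i j) level_gt.
  have := level_le x i; have := level_gt x i; rewrite ltr_norml => ? ?.
  by apply/andP; split; lra.
left; split; first by exists P; split=> // k k0k; rewrite (yE k k0k) -yP /y addnA subnKC.
have amax i : alpha_at W gamma i <= alpha_max W gamma.
  exact: (le_bigmax _ (alpha_at W gamma)).
have dist (x : 'cV[R]_n) : (forall i, `|x i 0 - M%:~R| <= alpha_at W gamma i) ->
  forall i j : 'I_n, `|x i 0 - x j 0| <= alpha_at W gamma i + alpha_at W gamma j.
  move=> bx i j; have := bx i; have := bx j; rewrite !ler_norml.
  by move=> /andP[? ?] /andP[? ?]; apply/andP; split; lra.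
move=> k k0k; rewrite (yE k k0k); split=> [|i]; first exact: dist.
rewrite -(traj_average x0 hW k) (yE k k0k); set x := y _.
have near j : x i 0 - 2 * alpha_max W gamma <= x j 0 <= x i 0 + 2 * alpha_max W gamma.
  have := dist x (band _) i j; have := amax i; have := amax j.
  by rewrite ler_norml => ? ? /andP[? ?]; apply/andP; split; lra.
have lo : x i 0 - 2 * alpha_max W gamma <= average x.
  by apply: average_ge => // j; have /andP[] := near j.
have hi : average x <= x i 0 + 2 * alpha_max W gamma.
  by apply: average_le => // j; have /andP[] := near j.
by rewrite ler_norml; apply/andP; split; lra.
Qed.
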